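(* Let $d$ be a positive integer. If $X$ and $Y$ are (topologically) conjugate $\mathbb{Z}^d$ shifts of finite type and $X$ has the finite extension property, then $Y$ has the finite extension property.
   Context: For $k\ge 0$, $Q_k=[-k,k]^d$ (integer points). A pattern over a finite alphabet $\mathcal{A}$ is an element $w$ of $\mathcal{A}^S$ for some $S\subset\mathbb{Z}^d$, called its shape; it is a finite pattern if $S$ is finite. Patterns are considered up to translation: $u\in\mathcal{A}^S$ and $v\in\mathcal{A}^{S+t}$ are identified if $u(s)=v(s+t)$ for all $s\in S$. Thus a pattern contains a pattern $w$ if one of its restrictions equals $w$ up to translation. The shift action on $\mathcal{A}^{\mathbb{Z}^d}$ is $(\sigma_t x)(s)=x(s+t)$. A $\mathbb{Z}^d$ subshift is a subset of $\mathcal{A}^{\mathbb{Z}^d}$ ($\mathcal{A}$ a finite alphabet) that is closed in the product of discrete topologies and invariant under all $\sigma_t$, $t\in\mathbb{Z}^d$. For a set $\mathcal{F}$ of finite patterns, $X(\mathcal{F})$ is the set of $x\in\mathcal{A}^{\mathbb{Z}^d}$ containing no pattern from $\mathcal{F}$. A $\mathbb{Z}^d$ shift of finite type (SFT) is a subshift of the form $X(\mathcal{F})$ with $\mathcal{F}$ a finite set of finite patterns. The language $L(X)$ is the set of all patterns (finite or infinite) appearing in points of $X$. A topological conjugacy between subshifts $X$ and $Y$ (possibly over different alphabets) is a continuous bijection $\phi:X\to Y$ with $\phi\circ\sigma_t=\sigma_t\circ\phi$ for all $t\in\mathbb{Z}^d$; $X$ and $Y$ are conjugate if one exists. For $g\in\mathbb{N}$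 (with $0$ allowed), a $\mathbb{Z}^d$ SFT $X$ has the $g$-extension property if there exists a finite set $\mathcal{F}$ of forbidden finite patterns with $X=X(\mathcal{F})$ and the following property: if a pattern $w$ with shape $S$ (finite or infinite) can be extended to a pattern on $S+Q_g$ which does not contain any patterns from $\mathcal{F}$, then $w\in L(X)$, i.e. $w$ can be extended to a point on all of $\mathbb{Z}^d$ containing no patterns from $\mathcal{F}$. $X$ has the finite extension property if it has the $g$-extension property for some $g$. *)

(* Defs.v *)
From mathcomp Require Import all_boot all_order all_algebra.
From mathcomp Require Import boolp classical_sets functions cardinality topology.

Set Implicit Arguments.
Unset Strict Implicit.
Unset Printing Implicit Defensive.

Import Order.TTheory GRing.Theory Num.Theory.

Local Open Scope classical_set_scope.
Local Open Scope ring_scope.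

Definition config (d : nat) (A : finType) : Type :=
  prod_topology (fun _ : 'rV[int]_d => discrete_topology A).

Definition shift d (A : finType) (t : 'rV[int]_d) (x : config d A) :
  config d A := fun s => x (s + t).

Definition is_subshift d (A : finType) (X : set (config d A)) : Prop :=
  closed X /\ forall t x, X x -> X (shift t x).

(* An element of A^S, for an arbitrary S, is encoded as a partial function
   which is defined exactly on S. Patterns are representatives: identification
   up to translation is built into [contains]. *)
Definition pattern (d : nat) (A : finType) : Type := 'rV[int]_d -> option A.

Definition pattern_shape d (A : finType) (w : pattern d A) : set 'rV[int]_d :=
  [set s | isSome (w s)].

Definition point_pattern d (A : finType) (x : config d A) : pattern d A :=
  fun s => Some (x s).

Definition contains d (A : finType) (v w : pattern d A) : Prop :=
  exists t, forall s, pattern_shape w s -> v (s + t) = w s.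

Definition extends d (A : finType) (v w : pattern d A) : Prop :=
  forall s, pattern_shape w s -> v s = w s.

Definition avoids d (A : finType) (F : set (pattern d A)) (v : pattern d A) :
  Prop := forall w, F w -> ~ contains v w.

Definition avoiding d (A : finType) (F : set (pattern d A)) :
  set (config d A) := [set x | avoids F (point_pattern x)].

Definition finite_patterns d (A : finType) (F : set (pattern d A)) : Prop :=
  finite_set F /\ forall w, F w -> finite_set (pattern_shape w).

Definition is_sft d (A : finType) (X : set (config d A)) : Prop :=
  is_subshift X /\ exists2 F, finite_patterns F & X = avoiding F.

Definition language d (A : finType) (X : set (config d A)) :
  set (pattern d A) :=
  [set w | exists2 x, X x & contains (point_pattern x) w].

Definition cube d (k : nat) : set 'rV[int]_d :=
  [set q | forall i, - k%:Z <= q 0 i <= k%:Z].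

Definition extension_property d (A : finType) (g : nat)
    (X : set (config d A)) : Prop :=
  exists F : set (pattern d A),
    [/\ finite_patterns F, X = avoiding F &
        forall w : pattern d A,
          (exists v : pattern d A,
            [/\ pattern_shape v = [set s + q | s in pattern_shape w & q in cube g],
                extends v w & avoids F v]) ->
          language X w].

Definition finite_extension_property d (A : finType)
    (X : set (config d A)) : Prop :=
  exists g, extension_property g X.

(* [phi] is a map between the subspaces X and Y themselves; the last clause is
   phi \o shift t = shift t \o phi, where x' is the point of X underlying the
   shift of x (it exists since X is shift-invariant). *)
Definition conjugate d (A B : finType) (X : set (config d A))
    (Y : set (config d B)) : Prop :=
  exists phi : X -> Y,
    [/\ continuous phi, bijective phi &
        forall t (x x' : X), val x' = shift t (val x) ->
          val (phi x') = shift t (val (phi x))].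

(* Main.v *)
Require Import Defs.
From mathcomp Require Import all_boot all_order all_algebra.
From mathcomp Require Import boolp classical_sets functions cardinality topology.
From mathcomp Require Import finmap zify.

Set Implicit Arguments.
Unset Strict Implicit.
Unset Printing Implicit Defensive.

Import Order.TTheory GRing.Theory Num.Theory.

Local Open Scope classical_set_scope.
Local Open Scope ring_scope.

(** The idea is to carry a partial pattern of Y to X with the inverse of the
conjugacy [phi], complete it there, and come back. By compactness (the
Curtis-Hedlund-Lyndon theorem, [block_code]) there is a radius [r] such that
[phi x] at [s] depends only on [x] on [s + Q_r], and [x] at [s] depends only on
[phi x] on [s + Q_r]. So the inverse of [phi] also applies to a mere pattern [v],
provided that every window of [v] occurs in a point of Y, and it costs a margin
of width [r].

Let X have the [g]-extension property for [F], whose shapes lie in [Q_M]. For Y,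
forbid all the patterns with shape inside a large cube [Q_N] that do not occur in
Y ([unseen Y N]). There are finitely many, and they define Y as soon as [Q_N]
contains the shapes of some finite set of patterns defining Y
([avoiding_unseen]). If [v] avoids them, then around each point it coincides on
the scale [N] with a point of Y ([avoids_unseen_local]).

Suppose that such a [v] extends [w], of shape [S], to [S + Q_(2r+g)]. Its decoding
[u] is defined on [S + Q_(r+g)]. It avoids [F]: an occurrence of a pattern of [F]
would fit in a translate of [Q_M], where [u] is the decoding of a window of [v] of
size [M + r], hence coincides with a point of X. The extension property of X yields
a point [x] of X equal to [u] on [S + Q_r]. Finally [phi x] equals [w] on [S],
because near each [s] in [S] the pattern [v] is a piece of some [phi z], and then
[x] and [z] agree on [s + Q_r]. *)

(** * Cubes and patterns of bounded shape *)

Lemma cube0 d k : cube k (0 : 'rV[int]_d).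
Proof. by move=> i; rewrite mxE; lia. Qed.

Lemma sub_cube d m n : (m <= n)%N -> cube m `<=` @cube d n.
Proof. by move=> mn q qm i; have := qm i; lia. Qed.

Lemma cubeD d m n (p q : 'rV[int]_d) :
  cube m p -> cube n q -> cube (m + n) (p + q).
Proof.
move=> pm qn i; rewrite mxE PoszD opprD.
by have [/andP[? ?] /andP[? ?]] := (pm i, qn i); rewrite !lerD.
Qed.

Lemma finite_sub_cube d (D : set 'rV[int]_d) :
  finite_set D -> exists k, D `<=` cube k.
Proof.
move=> /finite_fsetP[E ->].
exists (\max_(s <- E) \max_(i < d) `|s 0%R i|%N)%N => s /= sE i.
set k := (\max_(s <- E) _)%N; have : (`|s 0%R i| <= k)%N; last by lia.
apply: (leq_trans (@leq_bigmax _ (fun i => `|s 0%R i|%N) i)).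
exact: (@leq_bigmax_seq _ (enum_fset E) predT
  (fun s : 'rV[int]_d => \max_(i < d) `|s 0%R i|)%N s sE isT).
Qed.

Lemma in_some_cube d (s : 'rV[int]_d) : exists k, cube k s.
Proof. by have [k sk] := finite_sub_cube (finite_set1 s); exists k; exact: sk. Qed.

Lemma finite_cube d k : finite_set (@cube d k).
Proof.
pose f (j : 'rV['I_(k + k).+1]_d) : 'rV[int]_d :=
  \row_i ((j 0 i : nat)%:Z - k%:Z).
apply: (@sub_finite_set _ _ (range f)); last exact/finite_image/finite_finset.
move=> q qk; exists (\row_i inord `|(q 0 i + k%:Z)%R|%N) => //.
apply/rowP => i; rewrite !mxE inordK; have := qk i; lia.
Qed.

Lemma finite_patterns_on d (A : finType) (D : set 'rV[int]_d) :
  finite_set D -> finite_set [set p : pattern d A | pattern_shape p `<=` D].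
Proof.
move=> /finite_fsetP[E ->].
pose f (h : {ffun E -> option A}) : pattern d A :=
  fun s => if insub s is Some e then h e else None.
apply: (@sub_finite_set _ _ (range f)); last exact/finite_image/finite_finset.
move=> p pE; exists [ffun e => p (val e)] => //.
apply/funext => s; rewrite /f; case: insubP => [e _ <-|sE]; first by rewrite ffunE.
case ps : (p s) => [a|//]; case/negP: sE.
by apply: pE; rewrite /pattern_shape /= ps.
Qed.

Lemma finite_patterns_bounded d (A : finType) (F : set (pattern d A)) :
  finite_patterns F -> exists k, forall w, F w -> pattern_shape w `<=` cube k.
Proof.
move=> [finF finw].
have [k hk] := finite_sub_cube (bigcup_finite finF finw).
by exists k => w Fw s ws; apply: hk; exists w.
Qed.

(** Besides the patterns of shape exactly the cube, this contains those of smaller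
shape. So it includes the patterns of bounded shape that define X, and when X is
empty it includes the empty pattern, which excludes every pattern; the empty
subshift needs no separate treatment. *)
Definition unseen d (A : finType) (X : set (config d A)) (k : nat) :
    set (pattern d A) :=
  [set p | pattern_shape p `<=` cube k /\ ~ language X p].

Lemma finite_patterns_unseen d (A : finType) (X : set (config d A)) k :
  finite_patterns (unseen X k).
Proof.
split=> [|w [wk _]]; last exact: (sub_finite_set wk (@finite_cube d k)).
apply: sub_finite_set (finite_patterns_on A (@finite_cube d k)).
by move=> w [].
Qed.

Lemma avoiding_unseen d (A : finType) (X : set (config d A)) F k :
  X = avoiding F -> (forall w, F w -> pattern_shape w `<=` cube k) ->
  X = avoiding (unseen X k).
Proof.
move=> XF Fk; apply/seteqP; split=> x.
  by move=> Xx w [_ nw] xw; apply: nw; exists x.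
move=> xk; rewrite XF => w Fw; apply: xk; split; first exact: Fk.
by case=> y; rewrite XF => /(_ w Fw).
Qed.

(** The restriction of [v] to a translate of the cube is, translated back to the
origin, a pattern contained in [v] with shape inside the cube. As it is not in
[unseen X k], it occurs in X. The cube may stick out of the shape of [v]. *)
Lemma avoids_unseen_local d (A : finType) (X : set (config d A)) k
    (v : pattern d A) :
  (forall t x, X x -> X (shift t x)) -> avoids (unseen X k) v ->
  forall t, exists2 x, X x &
    forall q, cube k q -> pattern_shape v (t + q) -> v (t + q) = Some (x (t + q)).
Proof.
move=> Xshift vk t.
pose p : pattern d A := fun q => if `[< cube k q >] then v (q + t) else None.
have pk : pattern_shape p `<=` cube k.
  by move=> q; rewrite /pattern_shape /p /=; case: asboolP.
have vp : contains v p.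
  exists t => s sp; have sk := pk _ sp.
  by rewrite /p; case: asboolP.
have [x Xx [t' xp]] : language X p.
  by apply: contrapT => np; exact: vk vp.
exists (shift (t' - t) x); first exact: Xshift.
move=> q qk vq; have pq : p q = v (t + q).
  by rewrite /p addrC; case: asboolP.
rewrite -pq -xp /pattern_shape /= ?pq //.
by rewrite /point_pattern /shift (addrC t' (- t)) addrA [t + q]addrC addrK.
Qed.

(** * Sliding block codes by compactness *)

(** The domain of a conjugacy is the subtype of points of X, so compactness has to be
moved from the subset to the subtype. *)
Lemma compact_set_type (T : topologicalType) (K : set T) :
  compact K -> compact [set: K].
Proof.
move=> cK F PF _.
have [|x [Kx xF]] := cK _ (fmap_proper_filter set_val PF).
  by rewrite nbhs_simpl; apply: (@filterE _ F) => x; exact: set_valP.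
exists (SigSub (mem_set Kx)); split=> // P Q FP.
rewrite nbhsE => -[_ [[U oU <-] /= Ux] UQ].
have FP' : nbhs (set_val @ F) (set_val @` P).
  by rewrite nbhs_simpl /=; apply: filterS FP => y Py; exists y.
have [y [[y' Py' <-] Uy]] := xF _ _ FP' (open_nbhs_nbhs (conj oU Ux)).
by exists y'; split=> //; exact: UQ.
Qed.

(** If no window [W n] were large enough, there would be pairs [a n] which agree under
[f] on [W n] but are separated by [h]. At a cluster point [(p, q)] of these pairs in
[T * T], local constancy gives both [f p = f q] and [h p <> h q], against the
hypothesis that [h] factors through [f]. Asking that [h] factor through [f], instead
of being a function of [f p], lets one statement cover a map and its inverse. *)
Lemma locally_constant_factor (T : topologicalType) (I C V : Type)
    (W : nat -> set I) (f : T -> I -> C) (h : T -> V) :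
  compact [set: T] ->
  (forall m n, (m <= n)%N -> W m `<=` W n) -> (forall i, exists n, W n i) ->
  (forall i p, \forall q \near p, f q i = f p i) ->
  (forall p, \forall q \near p, h q = h p) ->
  (forall p q, f p = f q -> h p = h q) ->
  exists n, forall p q, (forall i, W n i -> f p i = f q i) -> h p = h q.
Proof.
move=> cT Wmono Wcover fcont hcont fh; apply: contrapT => no_window.
have /choice[a aP] n : exists a : T * T,
    (forall i, W n i -> f a.1 i = f a.2 i) /\ h a.1 <> h a.2.
  apply: contrapT => na; apply: no_window; exists n => p q pq.
  by apply: contrapT => hpq; apply: na; exists (p, q).
have cTT := compact_setX cT cT.
have [|[p q] [_ pqa]] := cTT (a @ \oo) _; first exact: filterE.
have visit n (P Q : set T) : nbhs p P -> nbhs q Q ->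
    exists m, [/\ (n <= m)%N, P (a m).1 & Q (a m).2].
  move=> nP nQ.
  have tail : nbhs (a @ \oo) (a @` [set m | (n <= m)%N]).
    by exists n => // m nm; exists m.
  have PQ : nbhs (p, q) (P `*` Q) by exists (P, Q).
  have [_ [[m nm <-] [/= ? ?]]] := pqa _ _ tail PQ.
  by exists m.
have [m [_ hp hq]] := visit 0 _ _ (hcont p) (hcont q).
have [_] := aP m; apply; rewrite hp hq; apply: fh; apply/funext => i.
have [n ni] := Wcover i.
have [m' [nm' <- <-]] := visit n _ _ (fcont i p) (fcont i q).
exact: (aP m').1 _ (Wmono _ _ nm' _ ni).
Qed.

Lemma config_compact d (A : finType) : compact [set: config d A].
Proof.
have cA : compact [set: discrete_topology A].
  exact/finite_compact/(@finite_finset A).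
have := @tychonoff 'rV[int]_d (fun=> discrete_topology A) (fun=> setT) (fun=> cA).
by move=> cconfig; apply: (subclosed_compact closedT cconfig).
Qed.

Lemma config_coord_near (T : topologicalType) d (A : finType)
    (f : T -> config d A) : continuous f ->
  forall s p, \forall q \near p, f q s = f p s.
Proof.
move=> cf s p.
have nU : nbhs (f p) [set y : config d A | y s = f p s].
  have := @proj_continuous _ (fun _ : 'rV[int]_d => discrete_topology A) s (f p).
  by move=> /(_ _ (discrete_set1 (f p s))).
exact: (cf p _ nU).
Qed.

(** The Curtis-Hedlund-Lyndon theorem for the correspondence [f x |-> h x]. With [f]
the inclusion it says that [h] is a block code; with [h] the inclusion and [f]
injective, that the inverse of [f] is one, which also proves that this inverse is
continuous. Equivariance reduces the claim to [s = 0]. *)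
Lemma block_code d (A B C : finType) (X : set (config d A))
    (f : X -> config d B) (h : X -> config d C) :
  is_subshift X -> continuous f -> continuous h ->
  (forall t (x x' : X), val x' = shift t (val x) -> f x' = shift t (f x)) ->
  (forall t (x x' : X), val x' = shift t (val x) -> h x' = shift t (h x)) ->
  (forall x x', f x = f x' -> h x = h x') ->
  exists r, forall x x' s,
    (forall q, cube r q -> f x (s + q) = f x' (s + q)) -> h x s = h x' s.
Proof.
move=> [clX Xshift] cf ch fshift hshift fh.
have cX : compact [set: X].
  exact/compact_set_type/(subclosed_compact clX (@config_compact d A)).
have [| | | | |r rP] := @locally_constant_factor X _ _ _ (@cube d) f
  (fun x => h x 0) cX.
- exact: sub_cube.
- exact: in_some_cube.
- exact: config_coord_near.
- exact: config_coord_near.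
- by move=> x x' /fh ->.
exists r => x x' s xx'.
have /all_sig[tau tauE] (z : X) : {z' : X | val z' = shift s (val z)}.
  by exists (SigSub (mem_set (Xshift s _ (set_valP z)))).
have := rP (tau x) (tau x').
rewrite !(hshift _ _ _ (tauE _)) !(fshift _ _ _ (tauE _)) /shift add0r; apply.
by move=> q qr; rewrite addrC; exact: xx'.
Qed.

(** * Transfer of the extension property along a conjugacy *)

Theorem theorem2p14 (d : nat) (d_gt0 : (0 < d)%N) (A B : finType)
    (X : set (config d A)) (Y : set (config d B)) :
  is_sft X -> is_sft Y -> conjugate X Y ->
  finite_extension_property X -> finite_extension_property Y.
Proof.
move=> [subX _] [[_ Yshift] [G finG YG]] [phi [cphi bphi phishift]]
  [g [F [finF XF Fext]]].
have [_ Xshift] := subX.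
have cval : continuous (val : X -> config d A) by exact: initial_continuous.
have cvalphi : continuous (val \o phi : X -> config d B).
  by move=> x; apply: (continuous_comp (cphi x)); exact: initial_continuous.
have valphi_shift t (x x' : X) :
    val x' = shift t (val x) -> (val \o phi) x' = shift t ((val \o phi) x).
  exact: phishift.
have [r1 code] := @block_code d A A B X val (val \o phi) subX cval cvalphi
  (fun _ _ _ => id) valphi_shift (fun x x' e => congr1 _ (val_inj e)).
have [r2 decode] := @block_code d A B A X (val \o phi) val subX cvalphi cval
  valphi_shift (fun _ _ _ => id)
  (fun x x' e => congr1 _ (bij_inj bphi (val_inj e))).
pose r := maxn r1 r2.
have [M FM] := finite_patterns_bounded finF.
have [K GK] := finite_patterns_bounded finG.
(* [K] makes the unseen patterns define Y, [M + r] serves to decode around an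
   occurrence of a pattern of [F], and [r + r] to decode and encode again. *)
pose N := (K + M + r + r)%N.
exists (r + g + r)%N, (unseen Y N); split.
- exact: finite_patterns_unseen.
- apply: (avoiding_unseen YG) => w /GK wK s /wK.
  by apply: sub_cube; rewrite /N; lia.
move=> w [v [vshape vw vN]].
have [psi phiK psiK] := bphi.
have local k t : (k <= N)%N -> exists x : X, forall q, cube k q ->
    pattern_shape v (t + q) -> v (t + q) = Some (val (phi x) (t + q)).
  move=> kN; have [y Yy yP] := avoids_unseen_local Yshift vN t.
  exists (psi (SigSub (mem_set Yy))); rewrite psiK => q qk; apply: yP.
  exact: sub_cube qk.
have vshapeD s q1 q2 q3 : pattern_shape w s -> cube r q1 -> cube g q2 ->
    cube r q3 -> pattern_shape v (s + q1 + q2 + q3).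
  move=> ws q1r q2g q3r; rewrite vshape.
  by exists s => //; exists (q1 + q2 + q3); [exact: cubeD (cubeD _ _) _|rewrite !addrA].
have rN : (r <= N)%N by rewrite /N; lia.
(* The point [xi s] has an image equal to [v] around [s], so its value at [s] is the
   decoding of [v] there. *)
have /choice[xi xiP] s := local r s rN.
pose S1 := [set s + q | s in pattern_shape w & q in cube r].
pose S2 := [set s + q | s in S1 & q in cube g].
have S12 : S1 `<=` S2.
  by move=> s S1s; exists s => //; exists 0; [exact: cube0|rewrite addr0].
have S2v s q : S2 s -> cube r q -> pattern_shape v (s + q).
  by move=> [_ [s0 ws0 [q1 q1r <-]] [q2 q2g <-]]; exact: vshapeD.
(* The decoding of [v], cut down to [D]. *)
pose u D : pattern d A := fun s =>
  if `[< D s >] then Some (val (xi s) s) else None.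
have uE (D : set 'rV[int]_d) s : D s -> u D s = Some (val (xi s) s).
  by move=> Ds; rewrite /u; case: asboolP.
have ushape D : pattern_shape (u D) = D.
  by apply/seteqP; split=> s; rewrite /pattern_shape /u /=; case: asboolP.
(* The decoding does not depend on the point which represents [v] around [s]. *)
have decode_u s (x : X) : S2 s ->
    (forall q, cube r q -> v (s + q) = Some (val (phi x) (s + q))) ->
    val (xi s) s = val x s.
  move=> S2s xP; apply: decode => q qr2.
  have qr : cube r q by apply: sub_cube qr2; rewrite /r; lia.
  have := xP q qr; rewrite xiP //; first by case.
  exact: S2v.
have [x Xx [t xt]] : language X (u S1).
  apply: Fext; exists (u S2); split.
  - by rewrite !ushape.
  - move=> s; rewrite ushape => S1s; rewrite !uE //; exact: S12.
  move=> p Fp [t tp].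
  have tS2 s : pattern_shape p s -> S2 (s + t).
    move=> ps; rewrite -(ushape S2) /pattern_shape /= tp //.
  have [|x xP] := local (M + r)%N t; first by rewrite /N; lia.
  have := set_valP x; rewrite [X in X _ -> _]XF => /(_ p Fp); apply.
  exists t => s ps; rewrite -tp // uE; last exact: tS2.
  congr Some; apply/esym/decode_u; first exact: tS2.
  move=> q qr; rewrite (addrC s) -addrA; apply: xP.
    by apply: cubeD => //; exact: FM ps.
  by rewrite addrA (addrC t); apply: S2v => //; exact: tS2.
pose x' : X := SigSub (mem_set (Xshift t _ Xx)).
exists (val (phi x')); first exact: set_valP.
exists 0 => s ws; rewrite addr0 /point_pattern.
have [|z zP] := local (r + r)%N s; first by rewrite /N; lia.
have wS1 q : cube r q -> S1 (s + q) by move=> qr; exists s => //; exists q.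
have vs : v s = Some (val (phi z) s).
  have := zP 0; rewrite addr0; apply; first exact: cube0.
  by have := vw s ws; rewrite /pattern_shape /= => ->.
rewrite -vw // vs; congr Some; apply: (code x' z) => q qr1.
have qr : cube r q by apply: sub_cube qr1; rewrite /r; lia.
have -> : val z (s + q) = val (xi (s + q)) (s + q).
  apply/esym/decode_u; first exact/S12/wS1.
  move=> q' q'r; rewrite -addrA; apply: zP; first exact: cubeD.
  by rewrite addrA; apply: S2v => //; exact/S12/wS1.
have := xt (s + q); rewrite ushape uE; last exact: wS1.
by move=> /(_ (wS1 _ qr)) [].
Qed.
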